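(* Let $N\ge1$, $0<B<N$, $\gamma>0$, $\lambda_i>0$, $k_i>0$ ($i=1,\dots,N$), and let $U_1,\dots,U_N:[0,1]\to\mathbb{R}$ be increasing, continuously differentiable and strictly concave. Assume that the unique maximizer $\mathbf{h}^*$ of $\sum_{i=1}^N U_i(h_i)$ subject to $\sum_{i=1}^N h_i=B$ and $0\le h_i\le1$ satisfies $0<h_i^*<1$ for all $i$, and let $\alpha^*$ be the corresponding Lagrange multiplier, i.e. $U_i'(h_i^* )=\alpha^*$ for all $i$. Suppose that either $h_i=f_i(t_i)=1-\frac{1}{1+\lambda_it_i}$ for all $i$ (non-reset TTL cache), or $h_i=f_i(t_i)=1-e^{-\lambda_it_i}$ for all $i$ (reset TTL cache), and that $t_i\ge0$ and $\alpha\ge0$ evolve in time according to \[ \dot t_i=\begin{cases}k_i[U_i'(h_i)-\alpha], & t_i>0,\\ \max\{0,k_i[U_i'(h_i)-\alpha]\}, & t_i=0,\end{cases} \qquad \dot\alpha=\begin{cases}\gamma\bigl(\sum_{i=1}^N h_i-B\bigr), & \alpha>0,\\ \max\bigl\{0,\gamma\bigl(\sum_{i=1}^N h_i-B\bigr)\bigr\}, & \alpha=0.\end{cases} \] Let $g_i(h)=f_i'(f_i^{-1}(h))$ for $h\in[0,1)$. Then \[ V(\mathbf{h},\alpha)=\sum_{i=1}^N\int_{h_i^*}^{h_i}\frac{x-h_i^*}{k_i\,g_i(x)}\,dx+\frac{1}{2\gamma}(\alpha-\alpha^* )^2 \] is a Lyapunov function for this system: $V\ge0$, $V(\mathbf{h},\alpha)=0$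 only at $(\mathbf{h}^*,\alpha^* )$, and $\dot V\le0$ along solutions. Moreover, from any initial condition, $(\mathbf{h},\alpha)$ converges to $(\mathbf{h}^*,\alpha^* )$ as time tends to infinity.
   Context: $h_i$ is the hit probability of file $i$ in a cache of size $B$ in which file $i$ has timer $t_i$ and Poisson request rate $\lambda_i$; $U_i$ is the utility of file $i$. The dynamics are the continuous-time version of the primal-dual update $t_i\gets\max\{0,t_i+k_i[U_i'(h_i)-\alpha]\}$, $\alpha\gets\max\{0,\alpha+\gamma(\sum_i h_i-B)\}$, where the current number of files in the cache is identified with $\sum_i h_i$. Solutions are absolutely continuous functions of time satisfying the differential equations for almost every time, and $\dot V$ is understood at such times. *)

(* Defs.v *)
(* MathComp-Analysis, over an arbitrary R : realType *)
From mathcomp Require Import all_boot all_order all_algebra.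
From mathcomp Require Import all_classical all_reals all_analysis.

Set Implicit Arguments.
Unset Strict Implicit.
Unset Printing Implicit Defensive.

Import Order.TTheory GRing.Theory Num.Theory.
Import numFieldNormedType.Exports.

Local Open Scope classical_set_scope.
Local Open Scope ring_scope.

Section RealFunctions.
Context {R : realType}.
Implicit Types (A : set R) (f : R -> R).

(* Difference quotients are taken inside A only, so that at the endpoints of
   a closed interval the derivative is one-sided. *)
Definition diff_quot f (x y : R) : R := (f y - f x) / (y - x).

Definition derivable_within A f (x : R) : Prop :=
  cvg (diff_quot f x y @[y --> within (A `\ x) (nbhs x)]).

Definition derive_within A f (x : R) : R :=
  lim (diff_quot f x y @[y --> within (A `\ x) (nbhs x)]).

Definition C1_on A f : Prop :=
  (forall x, A x -> derivable_within A f x) /\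
  {within A, continuous (derive_within A f)}.

Definition strictly_concave_on A f : Prop :=
  forall x y p : R, A x -> A y -> x != y -> 0 < p -> p < 1 ->
    p * f x + (1 - p) * f y < f (p * x + (1 - p) * y).

Definition abs_continuous_on (a b : R) f : Prop :=
  forall e : R, 0 < e -> exists2 d : R, 0 < d &
    forall (n : nat) (u v : 'I_n -> R),
      (forall j, a <= u j /\ u j <= v j /\ v j <= b) ->
      trivIset [set: 'I_n] (fun j => `]u j, v j[%classic) ->
      \sum_(j < n) (v j - u j) < d ->
      \sum_(j < n) `|f (v j) - f (u j)| < e.

Definition oriented_integral (a b : R) f : R :=
  if a <= b then \int[lebesgue_measure]_(x in `[a, b]) f x
  else - \int[lebesgue_measure]_(x in `[b, a]) f x.

End RealFunctions.

Inductive ttl_cache : Type := NonReset | Reset.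

Section Cache.
Context {R : realType}.

Definition hit (c : ttl_cache) (lam t : R) : R :=
  match c with
  | NonReset => 1 - 1 / (1 + lam * t)
  | Reset => 1 - expR (- (lam * t))
  end.

(* The inverse is that of the restriction of [hit c lam] to [0, +oo[. *)
Definition hit_rate (c : ttl_cache) (lam h : R) : R :=
  derive1 (hit c lam) (pinv [set t : R | 0 <= t] (hit c lam) h).

Context {N : nat}.
Implicit Types (U : 'I_N -> R -> R) (lam k h hstar : 'I_N -> R).

Definition feasible (B : R) h : Prop :=
  (forall i, 0 <= h i /\ h i <= 1) /\ \sum_(i < N) h i = B.

Definition maximizer U (B : R) h : Prop :=
  feasible B h /\
  forall h', feasible B h' -> \sum_(i < N) U i (h' i) <= \sum_(i < N) U i (h i).

Definition marginal_utility U (i : 'I_N) (x : R) : R :=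
  derive_within `[0, 1] (U i) x.

(* Rate of a state variable [x >= 0] driven by [v] and kept nonnegative. *)
Definition projected_rate (x v : R) : R := if 0 < x then v else Num.max 0 v.

(* The two-sided derivatives at time [s] exist and satisfy the dynamics. *)
Definition ode_at (c : ttl_cache) lam k U (gamma B : R)
    (t : 'I_N -> R -> R) (alpha : R -> R) (s : R) : Prop :=
  (forall i, is_derive s (1 : R) (t i)
     (projected_rate (t i s)
        (k i * (marginal_utility U i (hit c (lam i) (t i s)) - alpha s)))) /\
  is_derive s (1 : R) alpha
    (projected_rate (alpha s)
       (gamma * (\sum_(i < N) hit c (lam i) (t i s) - B))).

(* Time ranges over [0, +oo[; values at negative times are irrelevant. *)
Definition solution (c : ttl_cache) lam k U (gamma B : R)
    (t : 'I_N -> R -> R) (alpha : R -> R) : Prop :=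
  (forall s, 0 <= s -> (forall i, 0 <= t i s) /\ 0 <= alpha s) /\
  (forall T, 0 <= T ->
     (forall i, abs_continuous_on 0 T (t i)) /\ abs_continuous_on 0 T alpha) /\
  {ae lebesgue_measure, forall s : R,
     0 < s -> ode_at c lam k U gamma B t alpha s}.

Definition lyapunov (c : ttl_cache) lam k (gamma : R) hstar (alphastar : R)
    h (alpha : R) : R :=
  \sum_(i < N) oriented_integral (hstar i) (h i)
     (fun x => (x - hstar i) / (k i * hit_rate c (lam i) x))
  + 1 / (2 * gamma) * (alpha - alphastar) ^+ 2.

End Cache.

(* Main.v *)
(** Along a solution [V] has derivative at most [- D], where
    [D = \sum_i (h_i - h_i^* ) (alpha^* - U_i'(h_i))] is a sum of nonnegative
    terms because [U_i'] is strictly decreasing; the projections at [t_i = 0] and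
    [alpha = 0] only help. Absolute continuity turns this into monotonicity
    of [V], which bounds [alpha] and makes every [t_i] and [h_i] Lipschitz in
    time. If [h_i] kept returning to distance [e] from [h_i^*], it would stay at
    distance [e / 2] for a fixed duration each time, [V] dropping by a fixed
    amount, which [V >= 0] forbids. Hence [h_i] and [t_i] converge. As
    [alpha] is Lipschitz too, if it returned to distance [e] from [alpha^*], then
    [t_i] would move by a fixed amount at arbitrarily late times. *)

Require Import Defs.
From mathcomp Require Import all_boot all_order all_algebra.
From mathcomp Require Import all_classical all_reals all_analysis.
From mathcomp Require Import ring lra.

Set Implicit Arguments.
Unset Strict Implicit.
Unset Printing Implicit Defensive.

Import Order.TTheory GRing.Theory Num.Theory.
Import numFieldNormedType.Exports.

Local Open Scope classical_set_scope.
Local Open Scope ring_scope.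

(** * Absolutely continuous functions *)

Section AbsoluteContinuity.
Context {R : realType}.
Implicit Types (f g : R -> R) (a b c d e : R).

(** Straddle estimate: since [u <= s <= v], the increment splits at [s], and each half is controlled
    by the difference quotient at [s] alone. This is the local input to the supremum argument
    below. *)
Lemma is_derive_increment_le f s d c : is_derive s (1 : R) f d -> d < c ->
  exists2 r : R, 0 < r & forall u v, s - r < u -> u <= s -> s <= v ->
    v < s + r -> f v - f u <= c * (v - u).
Proof.
move=> [fd fE] dc.
have fdc : h^-1 *: (f (h *: 1 + s) - f s) @[h --> (0:R)^'] --> d.
  by rewrite -fE; exact: fd.
move/cvgrPdist_lt : fdc => /(_ (c - d)); rewrite subr_gt0 => /(_ dc).
rewrite near_withinE => /nbhs_ballP[r /= r0 hr].
exists r => // u v su us sv vs.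
have key h : `|h| < r -> h != 0 -> h^-1 * (f (h + s) - f s) < c.
  move=> hltr h0; have := hr h; rewrite /ball/= sub0r normrN => /(_ hltr h0).
  rewrite /GRing.scale/= mulr1.
  by rewrite ltr_norml => /andP[+ _]; lra.
have vle : f v - f s <= c * (v - s).
  have [->|vns] := eqVneq v s; first by rewrite !subrr mulr0.
  have vs0 : 0 < v - s by rewrite subr_gt0 lt_neqAle eq_sym vns.
  have := key (v - s); rewrite gtr0_norm// subrK (gt_eqF vs0) => /(_ _ isT).
  by rewrite mulrC ltr_pdivrMr// => /(_ _)/ltW; apply; lra.
have ule : f s - f u <= c * (s - u).
  have [->|uns] := eqVneq u s; first by rewrite !subrr mulr0.
  have us0 : u - s < 0 by rewrite subr_lt0 lt_neqAle uns.
  have := key (u - s); rewrite ltr0_norm// subrK (lt_eqF us0) => /(_ _ isT).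
  by rewrite mulrC ltr_ndivrMr// => /(_ _)/ltW H; have := H ltac:(lra); lra.
lra.
Qed.

(** Only increments of [g] and [f] over the segment are compared, so [g] can be the image of [f]
    under a map that is Lipschitz merely on the values [f] takes there. *)
Lemma abs_continuous_lipschitz_comp a b L f g :
  abs_continuous_on a b f -> 0 <= L ->
  (forall x y, a <= x <= b -> a <= y <= b ->
     `|g y - g x| <= L * `|f y - f x|) ->
  abs_continuous_on a b g.
Proof.
move=> ac L0 gf e e0.
(* Dividing by [L + 1] covers the case [L = 0]. *)
have L1 : 0 < L + 1 by rewrite ltr_wpDl.
have [d d0 H] := ac (e / (L + 1)) (divr_gt0 e0 L1).
exists d => // n u v uv tr sd.
have := H n u v uv tr sd; rewrite ltr_pdivlMr// => le1.
apply: le_lt_trans le1.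
rewrite mulr_suml; apply: ler_sum => j _.
have [? [? ?]] := uv j.
rewrite (le_trans (gf _ _ _ _))//; do 2?[apply/andP; split; lra].
by rewrite mulrC ler_wpM2l// lerDl.
Qed.

Lemma abs_continuous_add a b f g : abs_continuous_on a b f ->
  abs_continuous_on a b g -> abs_continuous_on a b (fun x => f x + g x).
Proof.
move=> fac gac e e0; have e20 : 0 < e / 2 by rewrite divr_gt0.
have [d d0 fd] := fac _ e20; have [d' d'0 gd] := gac _ e20.
exists (Num.min d d'); first by rewrite lt_min d0.
move=> n u v uv tr; rewrite lt_min => /andP[sd sd'].
have := fd n u v uv tr sd; have := gd n u v uv tr sd' => gl fl.
apply: (@le_lt_trans _ _ (\sum_(j < n) (`|f (v j) - f (u j)|
    + `|g (v j) - g (u j)|))).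
  apply: ler_sum => j _.
  by rewrite (_ : _ - _ = (f (v j) - f (u j)) + (g (v j) - g (u j)))
     ?ler_normD//; ring.
rewrite big_split/=; lra.
Qed.

Lemma abs_continuous_id a b : abs_continuous_on a b (fun x : R => x).
Proof.
move=> e e0; exists e => // n u v uv _; apply: le_lt_trans.
by apply: ler_sum => j _; have [_ [? _]] := uv j; rewrite ger0_norm ?subr_ge0.
Qed.

Lemma abs_continuous_cst a b c : abs_continuous_on a b (fun _ => c).
Proof.
apply: (@abs_continuous_lipschitz_comp _ _ 0 _ _ (abs_continuous_id a b)) => //.
by move=> x y _ _; rewrite subrr normr0 mul0r.
Qed.

Lemma abs_continuous_sum a b n (F : 'I_n -> R -> R) :
  (forall i, abs_continuous_on a b (F i)) ->
  abs_continuous_on a b (fun x => \sum_(i < n) F i x).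
Proof.
move=> Fac; elim: n F Fac => [|n IH] F Fac.
  rewrite (_ : (fun x => _) = fun=> 0); first exact: abs_continuous_cst.
  by apply/funext => x; rewrite big_ord0.
rewrite (_ : (fun x => _) =
    fun x => \sum_(i < n) F (widen_ord (leqnSn n) i) x + F ord_max x).
  by apply: abs_continuous_add; [exact: IH|exact: Fac].
by apply/funext => x; rewrite big_ord_recr.
Qed.

(** The intervals are listed from left to right, which makes them disjoint. Indices range over
    [nat], with values from [n] on ignored, so that an interval can be appended without changing the
    index type. *)
Let chain (O : set R) (a x : R) (n : nat) (u v : nat -> R) :=
  (forall j, (j < n)%N -> [/\ a <= u j, u j <= v j, v j <= x &
     `]u j, v j[%classic `<=` O]) /\
  (forall i j, (i < j < n)%N -> v i <= u j).

Let chain_trivIset (O : set R) a x n u v : chain O a x n u v ->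
  trivIset [set: 'I_n] (fun j : 'I_n => `]u j, v j[%classic).
Proof.
move=> [_ uv] i j _ _ [z] [/=]; rewrite !in_itv/= => /andP[? ?] /andP[? ?].
apply/eqP; rewrite -(inj_eq val_inj)/=; case: ltngtP => // [ij|ji].
- have := uv i j; rewrite ij ltn_ord => /(_ isT); lra.
- have := uv j i; rewrite ji ltn_ord => /(_ isT); lra.
Qed.

Let chain_length (O : set R) a x n u v : open O -> chain O a x n u v ->
  ((\sum_(j < n) (v j - u j))%:E <= lebesgue_measure O)%E.
Proof.
move=> oO ch; have tr := chain_trivIset ch; have [uv _] := ch.
have mI (j : 'I_n) : measurable (`]u j, v j[%classic : set R) by [].
rewrite (_ : (_)%:E = (\sum_(j < n) lebesgue_measure `]u j, v j[%classic)%E).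
  rewrite -(measure_bigsetU_ord (@lebesgue_measure R) xpredT mI tr).
  apply: le_measure; rewrite ?inE.
  - exact: bigsetU_measurable.
  - exact: measurable_realfun.open_measurable.
  - rewrite -(bigcup_mkord n (fun j => `]u j, v j[%classic)).
    move=> z [j /= jn zj].
    by have [_ _ _] := uv j jn; apply.
rewrite -sumEFin; apply: eq_bigr => j _.
have [_ uj _ _] := uv j (ltn_ord j).
rewrite lebesgue_measure_itv/= lte_fin; case: ltP => // vu.
by rewrite (_ : v j - u j = 0)//; apply/eqP; rewrite subr_eq0 eq_le vu uj.
Qed.

(* Points of [Z] are handled by absolute continuity on a small open cover,
   the others by the sign of the derivative; a supremum argument glues the local
   estimates together. *)
Lemma abs_continuous_nonincreasing a b f (Z : set R) : a <= b ->
  abs_continuous_on a b f -> lebesgue_measure.-negligible Z ->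
  (forall s, a <= s <= b -> ~ Z s -> forall e, 0 < e ->
    exists2 r : R, 0 < r & forall u v, s - r < u -> u <= s -> s <= v ->
    v < s + r -> f v - f u <= e * (v - u)) ->
  f b <= f a.
Proof.
move=> ab ac [A [mA A0 ZA]] hZ.
(* The number [e] is spent twice: as a slope, for a total of [e * (b - a)], and as a bound on the
   variation over intervals inside the open cover, whose measure is below the [d] of absolute
   continuity. *)
suff main e : 0 < e -> f b <= f a + e * (b - a + 1).
  apply/ler_addgt0Pr => e e0; have ba1 : 0 < b - a + 1 by lra.
  by have := main (e / (b - a + 1)) (divr_gt0 e0 ba1); rewrite divfK ?gt_eqF.
move=> e0; have [d d0 fd] := ac e e0.
have muA0 : lebesgue_measure A = 0%E by exact: A0.
have Afin : (lebesgue_measure A < +oo)%E by rewrite muA0 ltry.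
have [] := lebesgue_regularity_outer mA Afin d0 => O [oO AO OA].
have Od : (lebesgue_measure O < d%:E)%E.
  have mO : measurable O by exact: measurable_realfun.open_measurable.
  have OleA : (lebesgue_measure O <=
      lebesgue_measure A + lebesgue_measure (O `\` A))%E.
    rewrite -{1}(setDUK AO).
    exact: (measureU2 (@lebesgue_measure R) mA (measurableD mO mA)).
  by apply: le_lt_trans OleA _; rewrite muA0 add0e.
(* [Q] is kept additive: a step to the right either adds an interval inside [O] to the chain or is
   paid for by slope [e]. Absolute continuity is applied only once, at the end, through [Qe]. *)
pose Q x := exists n u v, chain O a x n u v /\
  f x - f a <= e * (x - a) + \sum_(j < n) `|f (v j) - f (u j)|.
have Qe x : x <= b -> Q x -> f x - f a <= e * (x - a) + e.
  move=> xb [n [u [v [ch fle]]]]; apply: (le_trans fle); rewrite lerD2l.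
  apply/ltW/(fd n (fun j : 'I_n => u j) (fun j : 'I_n => v j)).
  - by move=> j; have [? ? ? _] := ch.1 j (ltn_ord j); do !split => //; lra.
  - exact: chain_trivIset ch.
  - by rewrite -lte_fin; exact: le_lt_trans (chain_length oO ch) Od.
suff Qb : Q b by have := Qe b (lexx _) Qb; lra.
have Qa : Q a.
  exists 0, (fun=> 0), (fun=> 0); split.
    by split=> // i j; rewrite ltn0 andbF.
  by rewrite big_ord0 !subrr mulr0 addr0.
have Qstep x y : a <= x -> Q x -> x <= y ->
    `]x, y[%classic `<=` O \/ f y - f x <= e * (y - x) -> Q y.
  move=> ax [n [u [v [[ch ch'] fle]]]] xy [xyO|fxy].
  - exists n.+1, (fun j => if j == n then x else u j),
      (fun j => if j == n then y else v j); split.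
      split=> [j|i j].
        rewrite ltnS leq_eqVlt => /predU1P[->|jn]; first by rewrite eqxx.
        rewrite (ltn_eqF jn); have [? ? ? ?] := ch j jn.
        by split=> //; lra.
      rewrite ltnS => /andP[ij]; rewrite leq_eqVlt => /predU1P[jn|jn].
        rewrite jn eqxx; move: ij; rewrite jn => ij.
        by rewrite (ltn_eqF ij); have [] := ch i ij.
      rewrite (ltn_eqF jn) (ltn_eqF (ltn_trans ij jn)).
      by apply: ch'; rewrite ij.
    rewrite big_ord_recr/= eqxx.
    rewrite (eq_bigr (fun j : 'I_n => `|f (v j) - f (u j)|)); last first.
      by move=> j _; rewrite (ltn_eqF (ltn_ord j)).
    have := ler_norm (f y - f x).
    have : 0 <= e * (y - x) by rewrite mulr_ge0 ?(ltW e0)// subr_ge0.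
    lra.
  - exists n, u, v; split; last lra.
    by split=> // j jn; have [? ? ? ?] := ch j jn; split=> //; lra.
pose S := [set x | a <= x <= b /\ Q x].
have supS : has_sup S.
  by split; [exists a; split=> //; rewrite lexx|exists b => x [/andP[]]].
have Sa : S a by split=> //; rewrite lexx.
set m := sup S.
have am : a <= m by apply: ub_le_sup => //; case: supS.
have mb : m <= b by apply: ge_sup; [exists a|move=> x [/andP[]]].
(* At the supremum [m] one of the two kinds of step is available across [m]: by openness if [m] is
   in [O], by the local estimate otherwise, since [O] covers [Z]. *)
have [r r0 hr] : exists2 r : R, 0 < r & forall u v, m - r < u -> u <= m ->
    m <= v -> v < m + r ->
    `]u, v[%classic `<=` O \/ f v - f u <= e * (v - u).
  have [Om|nOm] := pselect (O m).
    have /nbhs_ballP[r /= r0 hr] := open_nbhs_nbhs (conj oO Om).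
    exists r => // u v mu um mv vm; left => z /=.
    rewrite in_itv/= => /andP[? ?].
    by apply: hr; rewrite /ball/= ltr_norml; lra.
  have nZm : ~ Z m by move=> /ZA /AO.
  have [|r r0 hr] := hZ m _ nZm e e0; first by rewrite am.
  by exists r => // u v *; right; exact: hr.
have [u [/andP[au ub] Qu] mu] := sup_adherent r0 supS.
have um : u <= m.
  by apply: ub_le_sup; [case: supS|split=> //; apply/andP].
(* One step leads from a point [u] of [S] close to [m] to [v]. As [v] cannot exceed the supremum,
   the minimum must be attained by [b]. *)
pose v := Num.min b (m + r / 2).
have mv : m <= v by rewrite le_min mb/=; lra.
have vr : v < m + r by rewrite gt_min; apply/orP; right; lra.
have Qv : Q v by apply: (Qstep u) => //; [lra|exact: hr].
have vm : v <= m.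
  apply: ub_le_sup; first by case: supS.
  by split=> //; rewrite (le_trans am)//= ge_min lexx.
have : v = b.
  by move: vm; rewrite /v /Num.min; case: ifP => // _; lra.
by move=> <-.
Qed.

Lemma abs_continuous_increment_le a b c f : a <= b ->
  abs_continuous_on a b f ->
  {ae lebesgue_measure, forall s, a < s < b ->
    exists2 d : R, is_derive s (1 : R) f d & d <= c} ->
  f b - f a <= c * (b - a).
Proof.
move=> ab ac df.
have gac : abs_continuous_on a b (fun x => f x + - c * x).
  apply: abs_continuous_add => //.
  apply: (@abs_continuous_lipschitz_comp _ _ `|c| _ _
    (abs_continuous_id a b)) => //.
  by move=> x y _ _; rewrite -mulrBr normrM normrN.
suff : f b + - c * b <= f a + - c * a by lra.
(* The derivative is known on the open interval only, so both endpoints are added to the exceptional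
   null set. *)
apply: (@abs_continuous_nonincreasing _ _ (fun x => f x + - c * x)
  (~` [set s | a < s < b ->
    exists2 d : R, is_derive s (1 : R) f d & d <= c]
    `|` ([set a] `|` [set b]))) => //.
  apply: negligibleU; first exact: df.
  apply: negligibleU.
    by exists [set a]; split=> //; exact: lebesgue_measure_set1.
  by exists [set b]; split=> //; exact: lebesgue_measure_set1.
move=> s /andP[sa sb] /not_orP[/contrapT hs /not_orP[/= nsa nsb]] e e0.
have [|d fd dc] := hs.
  by rewrite !lt_neqAle sa sb !andbT eq_sym; apply/andP; split; apply/eqP.
have dce : d < c + e by lra.
have [r r0 hr] := is_derive_increment_le fd dce.
by exists r => // u v su us sv vs; have := hr u v su us sv vs; lra.
Qed.

Lemma ae_imply (P Q : R -> Prop) : (forall s, P s -> Q s) ->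
  {ae lebesgue_measure, forall s : R, P s} ->
  {ae lebesgue_measure, forall s : R, Q s}.
Proof.
move=> PQ [Z [mZ Z0 sZ]]; exists Z; split=> // s nQ; apply: sZ => Ps.
exact/nQ/PQ.
Qed.

Lemma abs_continuous_increment_ge a b c f : a <= b ->
  abs_continuous_on a b f ->
  {ae lebesgue_measure, forall s, a < s < b ->
    exists2 d : R, is_derive s (1 : R) f d & c <= d} ->
  c * (b - a) <= f b - f a.
Proof.
move=> ab ac df.
suff : - f b - - f a <= - c * (b - a) by lra.
apply: (@abs_continuous_increment_le _ _ _ (fun x => - f x)) => //.
  apply: (abs_continuous_lipschitz_comp ac ler01) => x y _ _.
  by rewrite mul1r -opprD normrN.
apply: ae_imply df => s + sab => /(_ sab)[d fd cd].
by exists (- d); [exact: is_deriveN fd|rewrite lerN2].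
Qed.

Lemma abs_continuous_lipschitz a b L f : a <= b ->
  abs_continuous_on a b f ->
  {ae lebesgue_measure, forall s, a < s < b ->
    exists2 d : R, is_derive s (1 : R) f d & `|d| <= L} ->
  `|f b - f a| <= L * (b - a).
Proof.
move=> ab ac df; rewrite ler_norml -mulNr; apply/andP; split.
- apply: abs_continuous_increment_ge => //.
  apply: ae_imply df => s + sab => /(_ sab)[d fd].
  by rewrite ler_norml => /andP[dL _]; exists d.
- apply: abs_continuous_increment_le => //.
  apply: ae_imply df => s + sab => /(_ sab)[d fd].
  by rewrite ler_norml => /andP[_ dL]; exists d.
Qed.

Lemma abs_continuous_sub a b a' b' f : a <= a' -> b' <= b ->
  abs_continuous_on a b f -> abs_continuous_on a' b' f.
Proof.
move=> aa bb ac e /ac[d d0 fd]; exists d => // n u v uv; apply: fd => j.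
by have [? [? ?]] := uv j; do !split => //; lra.
Qed.

End AbsoluteContinuity.

(** * Derivatives of concave functions on a segment *)

Section OneSidedDerivative.
Context {R : realType}.
Variables (a b : R) (f : R -> R).
Hypothesis ab : a < b.
Local Notation I := (`[a, b]%classic : set R).

(** Properness of the filter that defines [derive_within] lets bounds on difference quotients pass
    to the limit. A nearby point is found to the right of [x] when [x < b], and to the left
    otherwise. *)
Lemma punctured_segment_proper x : a <= x <= b ->
  ProperFilter (within (I `\ x) (nbhs x)).
Proof.
move=> /andP[ax xb]; apply: within_nbhs_proper.
move=> A /nbhs_ballP[r /= r0 rA].
have [xltb|blex] := ltP x b.
  exists (x + Num.min (r / 2) (b - x)).
  have m0 : 0 < Num.min (r / 2) (b - x) by rewrite lt_min; lra.
  have mr : Num.min (r / 2) (b - x) <= r / 2 by rewrite ge_min lexx.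
  have mb : Num.min (r / 2) (b - x) <= b - x by rewrite ge_min lexx orbT.
  split.
    split; first by rewrite /= in_itv/=; lra.
    by move=> /= /eqP; apply/negP; rewrite gt_eqF// ltrDl.
  by apply: rA; rewrite /ball/= ltr_norml; lra.
exists (x - Num.min (r / 2) (x - a)).
have m0 : 0 < Num.min (r / 2) (x - a).
  rewrite lt_min !divr_gt0//= subr_gt0; exact: lt_le_trans ab blex.
have mr : Num.min (r / 2) (x - a) <= r / 2 by rewrite ge_min lexx.
have mb : Num.min (r / 2) (x - a) <= x - a by rewrite ge_min lexx orbT.
split.
  split; first by rewrite /= in_itv/=; lra.
  by move=> /= /eqP; apply/negP; rewrite lt_eqF// ltrBlDr ltrDl.
by apply: rA; rewrite /ball/= ltr_norml; lra.
Qed.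

Lemma derive_within_ge x m : a <= x <= b -> derivable_within I f x ->
  (exists2 r : R, 0 < r & forall y, a <= y <= b -> y != x -> `|x - y| < r ->
     m <= diff_quot f x y) ->
  m <= derive_within I f x.
Proof.
move=> xab df [r r0 hr]; have FF := punctured_segment_proper xab.
apply: limr_ge; first exact: df.
rewrite near_withinE; apply/nbhs_ballP; exists r => // y/= xy [].
by rewrite /= in_itv/= => yab /eqP yx; exact: hr.
Qed.

Lemma derive_within_le x m : a <= x <= b -> derivable_within I f x ->
  (exists2 r : R, 0 < r & forall y, a <= y <= b -> y != x -> `|x - y| < r ->
     diff_quot f x y <= m) ->
  derive_within I f x <= m.
Proof.
move=> xab df [r r0 hr]; have FF := punctured_segment_proper xab.
apply: limr_le; first exact: df.
rewrite near_withinE; apply/nbhs_ballP; exists r => // y/= xy [].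
by rewrite /= in_itv/= => yab /eqP yx; exact: hr.
Qed.

Lemma derive_within_ge0 x : a <= x <= b -> derivable_within I f x ->
  {in `[a, b] &, {homo f : x y / x <= y}} -> 0 <= derive_within I f x.
Proof.
move=> xab df fhomo; apply: derive_within_ge => //; exists 1 => // y yab yx _.
have xI : x \in `[a, b] by rewrite in_itv.
have yI : y \in `[a, b] by rewrite in_itv.
rewrite /diff_quot; have [xy|xy] := leP x y.
  by rewrite divr_ge0 ?subr_ge0// fhomo.
rewrite -mulrNN -invrN !opprB divr_ge0 ?subr_ge0//; last exact: ltW.
by rewrite fhomo// ltW.
Qed.

(** This is strict concavity with weight [(z - y) / (z - x)], cleared of denominators; comparisons
    of slopes then reduce to linear arithmetic in the products. *)
Lemma concave_chord x y z : strictly_concave_on I f ->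
  a <= x -> x < y -> y < z -> z <= b ->
  (z - y) * f x + (y - x) * f z < (z - x) * f y.
Proof.
move=> fc ax xy yz zb; have xz : 0 < z - x by lra.
have := fc x z ((z - y) / (z - x)).
rewrite /= !in_itv/= lt_eqF; last lra.
rewrite ltr_pdivlMr// ltr_pdivrMr// mul0r mul1r.
move=> /(_ _ _ isT) fxz.
have := fxz ltac:(lra) ltac:(lra) ltac:(lra) ltac:(lra).
have -> : 1 - (z - y) / (z - x) = (y - x) / (z - x) by field; lra.
have -> : (z - y) / (z - x) * x + (y - x) / (z - x) * z = y by field; lra.
rewrite -(ltr_pM2l xz).
by have -> : (z - x) * ((z - y) / (z - x) * f x + (y - x) / (z - x) * f z) =
  (z - y) * f x + (y - x) * f z by field; lra.
Qed.

(** The slopes of the two chords meeting at the midpoint separate the derivatives: the derivative at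
    [y] is at most the right slope, that at [x] at least the left one, and strictness comes from
    comparing the two chords. *)
Lemma derive_within_decreasing x y : strictly_concave_on I f ->
  derivable_within I f x -> derivable_within I f y ->
  a <= x -> x < y -> y <= b ->
  derive_within I f y < derive_within I f x.
Proof.
move=> fc dx dy ax xy yb; pose m := (x + y) / 2.
have xm : x < m by rewrite /m; lra.
have my : m < y by rewrite /m; lra.
apply: (@le_lt_trans _ _ (diff_quot f m y)).
  apply: derive_within_le => //; first lra.
  exists (y - m); first lra.
  move=> z /andP[az zb] zy; rewrite ltr_norml => /andP[z1 z2].
  rewrite /diff_quot; have [yz|yz] := ltP y z.
    rewrite ler_pdivrMr ?subr_gt0// mulrAC ler_pdivlMr ?subr_gt0//.
    have := @concave_chord m y z fc; lra.
  have {zy}yz : z < y by rewrite lt_neqAle zy.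
  have mz : m < z by lra.
  rewrite ler_ndivrMr ?subr_lt0// mulrAC ler_pdivrMr ?subr_gt0//.
  have := @concave_chord m z y fc; lra.
apply: (@lt_le_trans _ _ (diff_quot f x m)).
  rewrite /diff_quot ltr_pdivrMr ?subr_gt0// mulrAC ltr_pdivlMr ?subr_gt0//.
  have := @concave_chord x m y fc; lra.
apply: derive_within_ge => //; first lra.
exists (m - x); first lra.
move=> z /andP[az zb] zx; rewrite ltr_norml => /andP[z1 z2].
rewrite /diff_quot; have [xz|xz] := ltP x z.
  rewrite ler_pdivlMr ?subr_gt0// mulrAC ler_pdivrMr ?subr_gt0//.
  have := @concave_chord x z m fc; lra.
have {zx}xz : z < x by rewrite lt_neqAle zx.
rewrite ler_ndivlMr ?subr_lt0// mulrAC ler_pdivlMr ?subr_gt0//.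
have := @concave_chord z x m fc; lra.
Qed.

End OneSidedDerivative.

(** * Hit probabilities and the potential *)

Section HitProbability.
Context {R : realType}.
Implicit Types (c : ttl_cache) (lam t h hs k : R).

Lemma ln_lt_sub1 (x : R) : 0 < x -> x != 1 -> ln x < x - 1.
Proof.
move=> x0 x1; have lnx0 : ln x != 0 by rewrite ln_eq0.
by have := expR_gt1Dx lnx0; rewrite lnK ?posrE//; lra.
Qed.

(** Fundamental theorem of calculus for either order of the endpoints. A general interval [S] allows
    [[0, 1[], at whose right end the integrand of the potential is singular. *)
Lemma oriented_integral_primitive (f F : R -> R) (S : interval R) a b :
  a \in S -> b \in S ->
  {in S, continuous f} -> (forall x, x \in S -> is_derive x (1 : R) F (f x)) ->
  oriented_integral a b f = F b - F a.
Proof.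
move=> aS bS cf dF.
have sub x y z : x \in S -> y \in S -> x <= z <= y -> z \in S.
  case: S {aS bS cf dF} => l r; rewrite !itv_boundlr.
  move=> /andP[lx xr] /andP[ly yr] /andP[xz zy]; apply/andP; split.
    by apply: le_trans lx _; rewrite bnd_simp.
  by apply: le_trans _ yr; rewrite bnd_simp.
have main x y : x \in S -> y \in S -> x < y ->
    \int[lebesgue_measure]_(z in `[x, y]) f z = F y - F x.
  move=> xS yS xy; rewrite /Rintegral (@continuous_FTC2 R f F)//.
  - apply: continuous_in_subspaceT => z /set_mem/=; rewrite in_itv/= => zxy.
    by apply: cf; apply: sub zxy.
  - have cF z : z \in S -> {for z, continuous F}.
      move=> zS; apply/differentiable_continuous/derivable1_diffP.
      by case: (dF z zS).
    split.
    + move=> z; rewrite in_itv/= => /andP[/ltW xz /ltW zy].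
      by case: (dF z _) => //; apply: (sub x y); rewrite ?xz.
    + by apply: cvg_at_right_filter; exact: cF.
    + by apply: cvg_at_left_filter; exact: cF.
  - move=> z; rewrite in_itv/= => /andP[/ltW xz /ltW zy].
    by rewrite derive1E; case: (dF z _) => //; apply: (sub x y); rewrite ?xz.
rewrite /oriented_integral; case: ltgtP => [ab|ba|->]; first exact: main.
  by rewrite main// opprB.
by rewrite set_itv1 Rintegral_set1 subrr.
Qed.

(* [hit c lam] solves [h' = lam * decay c h], so that the paper's [g] is
   [lam * decay c]. *)
Definition decay c h : R :=
  match c with NonReset => (1 - h) ^+ 2 | Reset => 1 - h end.

(** The explicit inverse of [hit c lam], recovering the timer from the hit probability. *)
Definition timer c lam h : R :=
  match c with
  | NonReset => ((1 - h)^-1 - 1) / lam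
  | Reset => - ln (1 - h) / lam
  end.

(* A primitive of [x |-> (x - hs) / decay c x] on ]-oo, 1[. *)
Definition potential c hs h : R :=
  match c with
  | NonReset => ln (1 - h) + (1 - hs) / (1 - h)
  | Reset => - h - (1 - hs) * ln (1 - h)
  end.

Lemma decay_gt0 c h : h < 1 -> 0 < decay c h.
Proof. by case: c => /= h1; rewrite ?exprn_gt0 ?subr_gt0. Qed.

Lemma decay_le1 c h : 0 <= h < 1 -> decay c h <= 1.
Proof. by case: c => /= /andP[h0 h1]; rewrite ?expr_le1//; lra. Qed.

Lemma hit_range c lam t : 0 < lam -> 0 <= t -> 0 <= hit c lam t < 1.
Proof.
move=> lam0 t0; have lt0 : 0 <= lam * t by rewrite mulr_ge0// ltW.
case: c => /=; apply/andP; split.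
- rewrite subr_ge0 ler_pdivrMr; lra.
- by rewrite ltrBlDr ltrDl divr_gt0//; lra.
- by rewrite subr_ge0 -expR0 ler_expR oppr_le0.
- by rewrite ltrBlDr ltrDl expR_gt0.
Qed.

Lemma hit0 c lam : hit c lam 0 = 0.
Proof. by case: c; rewrite /= mulr0 ?addr0 ?divr1 ?oppr0 ?expR0 subrr. Qed.

Lemma timer_ge0 c lam h : 0 < lam -> 0 <= h < 1 -> 0 <= timer c lam h.
Proof.
move=> lam0 /andP[h0 h1]; case: c => /=; rewrite divr_ge0 ?(ltW lam0)//.
  by rewrite subr_ge0 invf_ge1; lra.
by rewrite oppr_ge0 ln_le0; lra.
Qed.

Lemma timerK c lam h : 0 < lam -> h < 1 -> hit c lam (timer c lam h) = h.
Proof.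
move=> lam0 h1; have h0 : 0 < 1 - h by rewrite subr_gt0.
case: c => /=.
  by rewrite [lam * _]mulrC divfK ?gt_eqF// subrKC div1r invrK; ring.
by rewrite mulrC divfK ?gt_eqF// opprK lnK ?posrE//; ring.
Qed.

Lemma hitK c lam t : 0 < lam -> 0 <= t -> timer c lam (hit c lam t) = t.
Proof.
move=> lam0 t0; have lt0 : 0 <= lam * t by rewrite mulr_ge0// ltW.
case: c => /=.
  by rewrite subKr div1r invrK addrAC subrr add0r mulrC mulKf// gt_eqF.
by rewrite subKr expRK opprK mulrC mulKf// gt_eqF.
Qed.

Lemma timer_continuous c lam h : h < 1 -> {for h, continuous (timer c lam)}.
Proof.
move=> h1; have h0 : 0 < 1 - h by rewrite subr_gt0.
have c1h : {for h, continuous (fun x : R => 1 - x)}.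
  by apply: cvgB; [exact: cvg_cst|exact: cvg_id].
case: c; apply: cvgM; try exact: cvg_cst.
  by apply: cvgB; [apply: cvgV => //; rewrite gt_eqF|exact: cvg_cst].
by apply: cvgN; apply: continuous_comp => //; exact: continuous_ln.
Qed.

Lemma is_derive_hit c lam t : 0 < lam -> 0 <= t ->
  is_derive t (1 : R) (hit c lam) (lam * decay c (hit c lam t)).
Proof.
move=> lam0 t0; have lt0 : 0 <= lam * t by rewrite mulr_ge0// ltW.
have dlin : is_derive t (1 : R) (fun x : R => lam * x) lam.
  by apply: is_derive_eq (is_deriveZ lam (is_derive_id t (1 : R))) _;
    rewrite /GRing.scale/= mulr1.
have d1 : is_derive t (1 : R) (fun _ : R => 1 : R) 0 by exact: is_derive_cst.
case: c => /=.
  have d1l : is_derive t (1 : R) (fun x : R => 1 + lam * x) (0 + lam).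
    exact: is_deriveD d1 dlin.
  have n0 : 1 + lam * t != 0 by rewrite gt_eqF//; lra.
  have dV := is_deriveB d1 (@is_deriveV _ (fun x => 1 + lam * x) _ _ _ n0 d1l).
  have -> : hit NonReset lam = fun x : R => 1 - (1 + lam * x)^-1.
    by apply/funext => x /=; rewrite div1r.
  by apply: is_derive_eq dV _; rewrite /GRing.scale/=; field.
have de : is_derive t (1 : R) (fun x : R => expR (- (lam * x)))
    (expR (- (lam * t)) * - lam).
  exact: is_derive1_comp (is_derive_expR _) (is_deriveN dlin).
by apply: is_derive_eq (is_deriveB d1 de) _; ring.
Qed.

Lemma is_derive_potential c hs h : h < 1 ->
  is_derive h (1 : R) (potential c hs) ((h - hs) / decay c h).
Proof.
move=> h1; have h0 : 0 < 1 - h by rewrite subr_gt0.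
have n0 : 1 - h != 0 by rewrite gt_eqF.
have d1h : is_derive h (1 : R) (fun x : R => 1 - x) (0 - 1).
  exact: is_deriveB (is_derive_cst _ _ _) (is_derive_id _ _).
have dln : is_derive h (1 : R) (fun x : R => ln (1 - x)) ((1 - h)^-1 * (0 - 1)).
  exact: (@is_derive1_comp _ (@ln R) (fun x => 1 - x) _ _ _
    (is_derive1_ln h0) d1h).
case: c => /=.
  have dV := is_deriveZ (1 - hs) (@is_deriveV _ (fun x => 1 - x) _ _ _ n0 d1h).
  by apply: is_derive_eq (is_deriveD dln dV) _; rewrite /GRing.scale/=; field.
have dN : is_derive h (1 : R) (fun x : R => - x) (- 1).
  exact: is_deriveN (is_derive_id _ _).
have dl : is_derive h (1 : R) (fun x : R => (1 - hs) * ln (1 - x))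
    ((1 - hs) *: ((1 - h)^-1 * (0 - 1))).
  exact: is_deriveZ dln.
by apply: is_derive_eq (is_deriveB dN dl) _; rewrite /GRing.scale/=; field.
Qed.

(* With [u = (1 - h) / (1 - hs)] the difference is [(1 - hs) * (u - 1 - ln u)]
   for [Reset] and [u^-1 - 1 - ln u^-1] for [NonReset]. *)
Lemma potential_gt c hs h : hs < 1 -> h < 1 -> h != hs ->
  potential c hs hs < potential c hs h.
Proof.
move=> hs1 h1 hhs; have h0 : 0 < 1 - h by rewrite subr_gt0.
have hs0 : 0 < 1 - hs by rewrite subr_gt0.
have hsn : 1 - hs != 0 by rewrite gt_eqF.
have hn : 1 - h != 0 by rewrite gt_eqF.
case: c => /=.
  have := @ln_lt_sub1 ((1 - hs) / (1 - h)) (divr_gt0 hs0 h0).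
  rewrite ln_div ?posrE// divff// => /(_ _)H.
  suff : (1 - hs) / (1 - h) != 1 by move=> /H; lra.
  apply/eqP => /(congr1 (fun z => z * (1 - h))); rewrite divfK// mul1r.
  by move=> e; move/eqP: hhs; apply; lra.
have := @ln_lt_sub1 ((1 - h) / (1 - hs)) (divr_gt0 h0 hs0).
rewrite ln_div ?posrE// => /(_ _)H.
suff /H : (1 - h) / (1 - hs) != 1.
  rewrite -(ltr_pM2l hs0) mulrBr [X in _ < X]mulrBr mulrCA divff//; lra.
apply/eqP => /(congr1 (fun z => z * (1 - hs))); rewrite divfK// mul1r.
by move=> e; move/eqP: hhs; apply; lra.
Qed.

(** Writing [h] as the hit probability of a nonnegative timer evaluates [pinv]; the injectivity this
    takes follows from the left inverse [timer]. *)
Lemma hit_rateE c lam h : 0 < lam -> 0 <= h < 1 ->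
  hit_rate c lam h = lam * decay c h.
Proof.
move=> lam0 h01; have [h0 h1] := andP h01.
have -> : h = hit c lam (timer c lam h) by rewrite timerK.
have tm0 := timer_ge0 c lam0 h01.
rewrite /hit_rate pinvKV ?inE//.
  by rewrite derive1E; have [_ ->] := is_derive_hit c lam0 tm0.
move=> x y; rewrite !inE/= => x0 y0 xy.
by rewrite -(hitK c lam0 x0) xy hitK.
Qed.

(** The integrand is first replaced by an explicit one, equal to it on [[0, 1[], which contains the
    whole range of integration; [potential] then provides a primitive. *)
Lemma oriented_integral_hit_rate c lam k hs h : 0 < lam -> 0 < k ->
  0 <= hs < 1 -> 0 <= h < 1 ->
  oriented_integral hs h (fun x => (x - hs) / (k * hit_rate c lam x)) =
  (potential c hs h - potential c hs hs) / (k * lam).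
Proof.
move=> lam0 k0 hs01 h01.
pose g x := (k * lam)^-1 * ((x - hs) / decay c x).
have -> : oriented_integral hs h (fun x => (x - hs) / (k * hit_rate c lam x)) =
    oriented_integral hs h g.
  have fg x : 0 <= x < 1 -> (x - hs) / (k * hit_rate c lam x) = g x.
    move=> x01; rewrite /g hit_rateE//; field.
    by rewrite !gt_eqF// decay_gt0//; case/andP: x01.
  by rewrite /oriented_integral; case: ifP => _; [|congr (- _)];
    apply: eq_Rintegral => x; rewrite inE/= in_itv/= => ?; apply: fg; lra.
have gc : {in `[0, 1[, continuous g}.
  move=> x; rewrite in_itv/= => /andP[x0 x1].
  apply: cvgM; first exact: cvg_cst.
  apply: cvgM; first by apply: cvgB; [exact: cvg_id|exact: cvg_cst].
  apply: cvgV; first by rewrite gt_eqF// decay_gt0.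
  have c1 : {for x, continuous (fun x : R => 1 - x)}.
    by apply: cvgB; [exact: cvg_cst|exact: cvg_id].
  by case: c @g => //=; apply: cvgM.
have gd (x : R) : x \in `[0, 1[ ->
    is_derive x (1 : R) (fun x => (k * lam)^-1 * potential c hs x) (g x).
  rewrite in_itv/= => /andP[x0 x1].
  exact: is_deriveZ (is_derive_potential c hs x1).
have -> := oriented_integral_primitive _ _ gc gd; rewrite ?in_itv//.
by rewrite -mulrBr mulrC.
Qed.

(** The factor [decay] in the derivative of [hit] cancels the denominator in that of [potential],
    which is the purpose of dividing by $g_i$ in $V$. As a function of the timer the potential thus
    has bounded slope, although in [h] it blows up at 1. *)
Lemma is_derive_potential_hit c lam hs t : 0 < lam -> 0 <= t ->
  is_derive t (1 : R) (fun x => potential c hs (hit c lam x))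
    (lam * (hit c lam t - hs)).
Proof.
move=> lam0 t0; have /andP[_ h1] := hit_range c lam0 t0.
apply: is_derive_eq (is_derive1_comp (is_derive_potential c hs h1)
  (is_derive_hit c lam0 t0)) _.
by field; rewrite gt_eqF// decay_gt0.
Qed.

Lemma lipschitz_of_is_derive (f df : R -> R) (L : R) :
  (forall x : R, 0 <= x -> is_derive x (1 : R) f (df x)) ->
  (forall x, 0 <= x -> `|df x| <= L) ->
  forall x y, 0 <= x -> 0 <= y -> `|f y - f x| <= L * `|y - x|.
Proof.
move=> fdf dfL x y; wlog xy : x y / x <= y.
  move=> H x0 y0; have [xy|/ltW yx] := leP x y; first exact: H.
  by rewrite distrC (distrC y); exact: H.
move=> x0 y0; have [||z] := @MVT_segment R f df x y xy.
- by move=> z; rewrite in_itv/= => /andP[/ltW xz _]; apply/fdf/(le_trans x0).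
- apply: derivable_within_continuous => z; rewrite in_itv/= => /andP[xz _].
  by case: (fdf z (le_trans x0 xz)).
rewrite in_itv/= => /andP[xz _] ->; rewrite normrM ler_wpM2r//.
by apply: dfL; apply: le_trans xz.
Qed.

Lemma hit_lipschitz c lam x y : 0 < lam -> 0 <= x -> 0 <= y ->
  `|hit c lam y - hit c lam x| <= lam * `|y - x|.
Proof.
move=> lam0; apply: (@lipschitz_of_is_derive _
  (fun t => lam * decay c (hit c lam t))) => [t t0|t t0].
  exact: is_derive_hit.
have h01 := hit_range c lam0 t0; have /andP[_ h1] := h01.
by rewrite normrM !gtr0_norm ?decay_gt0// ler_piMr ?decay_le1// ltW.
Qed.

Lemma potential_hit_lipschitz c lam hs x y : 0 < lam -> 0 <= hs <= 1 ->
  0 <= x -> 0 <= y ->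
  `|potential c hs (hit c lam y) - potential c hs (hit c lam x)|
    <= lam * `|y - x|.
Proof.
move=> lam0 hs01; apply: (@lipschitz_of_is_derive
  (fun t => potential c hs (hit c lam t))
  (fun t => lam * (hit c lam t - hs))) => [t t0|t t0].
  exact: is_derive_potential_hit.
have h01 := hit_range c lam0 t0.
rewrite normrM gtr0_norm// ler_piMr ?(ltW lam0)//.
by rewrite ler_norml; lra.
Qed.

End HitProbability.

(** * Primal-dual dynamics *)

Section ProjectedRate.
Context {R : realType}.
Implicit Types x y v : R.

(** Projection can only raise [v], and only when [x] is not positive; a factor [y <= 0] turns the
    raise into a decrease. Below, [y] is the deviation of a hit probability or of the price from
    equilibrium. *)
Lemma projected_rate_le x y v : 0 < x \/ y <= 0 ->
  y * projected_rate x v <= y * v.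
Proof.
rewrite /projected_rate; case: ifP => // _ [//|y0].
by rewrite ler_wnM2l// le_max lexx orbT.
Qed.

Lemma normr_projected_rate x v : `|projected_rate x v| <= `|v|.
Proof.
rewrite /projected_rate; case: ifP => // _; rewrite /Num.max.
by case: ifP => // _; rewrite normr0.
Qed.

End ProjectedRate.

(** * The Lyapunov function in closed form and its positive definiteness *)

Section LyapunovFunction.
Context {R : realType} {N : nat}.
Variables (gamma : R) (lam k : 'I_N -> R) (hstar : 'I_N -> R) (alphastar : R).
Variable c : ttl_cache.
Hypothesis hgamma : 0 < gamma.
Hypothesis hlam : forall i, 0 < lam i.
Hypothesis hk : forall i, 0 < k i.
Hypothesis hint : forall i, 0 < hstar i /\ hstar i < 1.

Local Notation V := (lyapunov c lam k gamma hstar alphastar).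

Let hstar01 i : 0 <= hstar i < 1.
Proof. by have [/ltW -> ->] := hint i. Qed.

(** The function [lyapunov] with its integrals evaluated. The two agree when all hit probabilities
    lie in [[0, 1[], and this form is open to the rules of differentiation. *)
Definition energy (h : 'I_N -> R) (alpha : R) : R :=
  \sum_(i < N) (k i * lam i)^-1 *
    (potential c (hstar i) (h i) - potential c (hstar i) (hstar i))
  + 1 / (2 * gamma) * (alpha - alphastar) ^+ 2.

Lemma lyapunovE h alpha : (forall i, 0 <= h i < 1) ->
  V h alpha = energy h alpha.
Proof.
move=> h01; rewrite /lyapunov /energy; congr (_ + _); apply: eq_bigr => i _.
by rewrite oriented_integral_hit_rate// mulrC.
Qed.

Let gain_ge0 i h : h < 1 -> 0 <= (k i * lam i)^-1 *
  (potential c (hstar i) h - potential c (hstar i) (hstar i)).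
Proof.
move=> h1; apply: mulr_ge0; first by rewrite invr_ge0 ltW// mulr_gt0.
rewrite subr_ge0.
have [->//|/eqP hh] := eqVneq h (hstar i).
by apply/ltW/potential_gt => //; [case: (hint i)|apply/eqP].
Qed.

Let gamma2 : 0 < 1 / (2 * gamma).
Proof. by rewrite divr_gt0 ?mulr_gt0. Qed.

Lemma energy_ge_price h alpha : (forall i, h i < 1) ->
  1 / (2 * gamma) * (alpha - alphastar) ^+ 2 <= energy h alpha.
Proof. by move=> h1; rewrite lerDr sumr_ge0// => i _; exact: gain_ge0. Qed.

Lemma energy_ge0 h alpha : (forall i, h i < 1) -> 0 <= energy h alpha.
Proof.
move=> h1; apply: le_trans (energy_ge_price alpha h1).
by rewrite mulr_ge0 ?sqr_ge0// ltW.
Qed.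

Lemma energy_eq0 h alpha : (forall i, h i < 1) ->
  energy h alpha = 0 <-> (forall i, h i = hstar i) /\ alpha = alphastar.
Proof.
move=> h1; split=> [/eqP|[hh ->]]; last first.
  rewrite /energy subrr expr0n mulr0 addr0 big1// => i _.
  by rewrite hh subrr mulr0.
rewrite paddr_eq0; last 2 first.
- by rewrite sumr_ge0// => i _; exact: gain_ge0.
- by rewrite mulr_ge0 ?sqr_ge0// ltW.
rewrite psumr_eq0; last by move=> i _; exact: gain_ge0.
move=> /andP[/allP Eh]; rewrite mulf_eq0 gt_eqF//= sqrf_eq0 subr_eq0 => /eqP ->.
split=> // i; apply/eqP/negP => /negP hi.
have /= := Eh i (mem_index_enum i); rewrite mulf_eq0 invr_eq0.
rewrite gt_eqF ?mulr_gt0//= subr_eq0 gt_eqF// potential_gt//.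
by case: (hint i).
Qed.

End LyapunovFunction.

(** * Marginal utilities and dissipation *)

Section Dynamics.
Context {R : realType} {N : nat}.
Variables (B gamma : R) (lam k : 'I_N -> R) (U : 'I_N -> R -> R).
Variables (hstar : 'I_N -> R) (alphastar : R) (c : ttl_cache).
Hypothesis hgamma : 0 < gamma.
Hypothesis hlam : forall i, 0 < lam i.
Hypothesis hk : forall i, 0 < k i.
Hypothesis hUincr : forall i, {in `[0, 1] &, {homo U i : x y / x <= y}}.
Hypothesis hUC1 : forall i, C1_on `[0, 1] (U i).
Hypothesis hUconc : forall i, strictly_concave_on `[0, 1] (U i).
Hypothesis hint : forall i, 0 < hstar i /\ hstar i < 1.
Hypothesis hsum : \sum_(i < N) hstar i = B.
Hypothesis hmult : forall i, marginal_utility U i (hstar i) = alphastar.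
Hypothesis alphastar_ge0 : 0 <= alphastar.

Local Notation mu := (marginal_utility U).
Local Notation E := (energy gamma lam k hstar alphastar c).

Let hstar01 i : 0 <= hstar i <= 1.
Proof. by have [/ltW -> /ltW ->] := hint i. Qed.

Let derivU i x : 0 <= x <= 1 -> derivable_within `[0, 1] (U i) x.
Proof. by move=> x01; apply: (hUC1 i).1; rewrite /= in_itv. Qed.

Lemma marginal_utility_ge0 i x : 0 <= x <= 1 -> 0 <= mu i x.
Proof.
move=> x01; apply: derive_within_ge0 => //; exact: derivU.
Qed.

Lemma marginal_utility_decreasing i x y : 0 <= x -> x < y -> y <= 1 ->
  mu i y < mu i x.
Proof.
move=> x0 xy y1; apply: derive_within_decreasing => //.
- by apply: derivU; lra.
- by apply: derivU; lra.
Qed.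

Lemma marginal_utility_nonincreasing i x y : 0 <= x -> x <= y -> y <= 1 ->
  mu i y <= mu i x.
Proof.
move=> x0; rewrite le_eqVlt => /predU1P[->//|xy] y1.
exact/ltW/marginal_utility_decreasing.
Qed.

Definition dissipation i x : R := (x - hstar i) * (alphastar - mu i x).

(** The two factors have the same sign, because [mu i] is nonincreasing and equals [alphastar] at
    [hstar i]. *)
Lemma dissipation_ge0 i x : 0 <= x <= 1 -> 0 <= dissipation i x.
Proof.
move=> /andP[x0 x1]; have [hs0 hs1] := hint i.
rewrite /dissipation -(hmult i); have [hx|xh] := leP (hstar i) x.
  have := marginal_utility_nonincreasing i (ltW hs0) hx x1.
  by move=> mm; rewrite mulr_ge0// subr_ge0.
have := marginal_utility_decreasing i x0 xh (ltW hs1).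
by move=> mm; rewrite mulr_le0 ?subr_le0// ltW.
Qed.

(** By monotonicity of [mu i], the gap to [alphastar] at distance at least [e] is no smaller than at
    [hstar i - e] or [hstar i + e], so [eta] is [e] times the smaller of these two gaps. *)
Lemma dissipation_ge_away i e : 0 < e -> e <= hstar i -> hstar i + e <= 1 ->
  exists2 eta : R, 0 < eta & forall x, 0 <= x <= 1 -> e <= `|x - hstar i| ->
    eta <= dissipation i x.
Proof.
move=> e0 eh eh1; have [hs0 hs1] := hint i.
have m1 : mu i (hstar i + e) < alphastar.
  by rewrite -(hmult i); apply: marginal_utility_decreasing; lra.
have m2 : alphastar < mu i (hstar i - e).
  by rewrite -(hmult i); apply: marginal_utility_decreasing; lra.
exists (e * Num.min (alphastar - mu i (hstar i + e))
                    (mu i (hstar i - e) - alphastar)).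
  by rewrite mulr_gt0// lt_min !subr_gt0 m1.
move=> x /andP[x0 x1]; rewrite /dissipation; have [hx|xh] := leP (hstar i) x.
  rewrite ger0_norm ?subr_ge0// => ex; apply: ler_pM => //.
  - exact: ltW.
  - by rewrite le_min !subr_ge0 !ltW.
  - rewrite ge_min lerD2l lerN2; apply/orP; left.
    by apply: marginal_utility_nonincreasing; lra.
rewrite ltr0_norm ?subr_lt0// -[_ * (alphastar - _)]mulrNN !opprB.
move=> ex; apply: ler_pM => //.
- exact: ltW.
- by rewrite le_min !subr_ge0 !ltW.
- rewrite ge_min lerD2r; apply/orP; right.
  by apply: marginal_utility_nonincreasing; lra.
Qed.

(** As [hstar i] is interior to the segment, continuity within the segment is ordinary continuity
    there. *)
Lemma marginal_utility_continuous i :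
  mu i x @[x --> hstar i] --> alphastar.
Proof.
have [hs0 hs1] := hint i; rewrite -(hmult i).
have /subspace_continuousP/(_ (hstar i)) := (hUC1 i).2.
rewrite /= in_itv/= => /(_ (hstar01 i)); rewrite within_interior//.
by rewrite interior_itv/= in_itv/= hs0.
Qed.

(** * Estimates along a solution *)

Section Trajectory.
Variables (t : 'I_N -> R -> R) (alpha : R -> R).
Hypothesis sol : solution c lam k U gamma B t alpha.

Local Notation ode := (ode_at c lam k U gamma B t alpha).
Local Notation H i s := (hit c (lam i) (t i s)).
Local Notation Es s := (E (fun i => H i s) (alpha s)).

Let t_ge0 i s : 0 <= s -> 0 <= t i s.
Proof. by move=> /(sol.1 _)[]. Qed.

Let alpha_ge0 s : 0 <= s -> 0 <= alpha s.
Proof. by move=> /(sol.1 _)[]. Qed.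

Let H01 i s : 0 <= s -> 0 <= H i s < 1.
Proof. by move=> s0; apply: hit_range => //; exact: t_ge0. Qed.

Let H1 i s : 0 <= s -> 0 <= H i s <= 1.
Proof. by move=> /(H01 i)/andP[-> /ltW ->]. Qed.

(** The weights $1/k_i$ and $1/\gamma$ remove the gains from the rates, after which the terms
    coupling the hit probabilities to [alpha s] cancel and minus the dissipation remains. *)
Lemma is_derive_energy s : 0 < s -> ode s ->
  exists2 d : R, is_derive s (1 : R) (fun r => Es r) d &
    d <= - \sum_(i < N) dissipation i (H i s).
Proof.
move=> s0 [dt da]; have s0' := ltW s0.
pose T i := projected_rate (t i s) (k i * (mu i (H i s) - alpha s)).
have {}dt i : is_derive s (1 : R) (t i) (T i) by exact: dt.
set A := projected_rate _ _ in da.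
have dterm i : is_derive s (1 : R) (fun r => (k i * lam i)^-1 *
    (potential c (hstar i) (H i r) - potential c (hstar i) (hstar i)))
    ((k i)^-1 * ((H i s - hstar i) * T i)).
  have dp := is_derive1_comp
    (is_derive_potential_hit c (hstar i) (hlam i) (t_ge0 i s0')) (dt i).
  have db := is_deriveB dp
    (is_derive_cst (potential c (hstar i) (hstar i)) s 1).
  apply: is_derive_eq (is_deriveZ (k i * lam i)^-1 db) _.
  by rewrite /GRing.scale/=; field; rewrite !gt_eqF.
have dq : is_derive s (1 : R)
    (fun r => 1 / (2 * gamma) * (alpha r - alphastar) ^+ 2)
    (gamma^-1 * ((alpha s - alphastar) * A)).
  have db := is_deriveB da (is_derive_cst alphastar s 1).
  apply: is_derive_eq (is_deriveZ (1 / (2 * gamma)) (is_deriveX 2 db)) _.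
  rewrite (_ : (alpha - cst alphastar) s = alpha s - alphastar)//.
  by rewrite /GRing.scale/= expr1; field; rewrite gt_eqF.
exists (\sum_(i < N) (k i)^-1 * ((H i s - hstar i) * T i) +
  gamma^-1 * ((alpha s - alphastar) * A)).
  rewrite (_ : (fun r => _) = (\sum_(i < N) (fun r : R => (k i * lam i)^-1 *
      (potential c (hstar i) (H i r) - potential c (hstar i) (hstar i)))) +
      (fun r => 1 / (2 * gamma) * (alpha r - alphastar) ^+ 2)).
    by apply: is_deriveD dq; exact: is_derive_sum dterm.
  by apply/funext => r; rewrite /energy /GRing.add/= fct_sumE.
(* Projection acts only at the boundary, where the deviation has the favourable sign: a zero timer
   gives [0 - hstar i], and a zero price gives [0 - alphastar]. *)
have Tle i : (k i)^-1 * ((H i s - hstar i) * T i) <=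
    (H i s - hstar i) * (mu i (H i s) - alpha s).
  rewrite mulrC ler_pdivrMr// -mulrA [_ * k i]mulrC.
  apply: projected_rate_le; have := t_ge0 i s0'; rewrite le_eqVlt.
  move=> /predU1P[<-|]; last by left.
  by right; rewrite hit0 sub0r oppr_le0 ltW//; case: (hint i).
have Ale : gamma^-1 * ((alpha s - alphastar) * A) <=
    (alpha s - alphastar) * (\sum_(i < N) H i s - B).
  rewrite mulrC ler_pdivrMr// -mulrA [_ * gamma]mulrC.
  apply: projected_rate_le; have := alpha_ge0 s0'; rewrite le_eqVlt.
  move=> /predU1P[<-|]; last by left.
  by right; rewrite sub0r oppr_le0.
apply: le_trans (lerD (ler_sum _ (fun i _ => Tle i)) Ale) _.
(* With [B] written as the sum of the [hstar i], the price term splits over the files and the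
   cancellation takes place term by term. *)
rewrite -hsum -sumrB mulr_sumr -big_split/= -sumrN.
by apply: ler_sum => i _; rewrite /dissipation; lra.
Qed.

Lemma price_lipschitz s r : 0 <= s -> s <= r ->
  `|alpha r - alpha s| <= gamma * (N%:R + `|B|) * (r - s).
Proof.
move=> s0 sr; have r0 := le_trans s0 sr.
apply: abs_continuous_lipschitz => //.
  exact: abs_continuous_sub s0 (lexx r) (sol.2.1 _ r0).2.
apply: ae_imply sol.2.2 => z + /andP[sz _] => /(_ (le_lt_trans s0 sz))[_ da].
exists (projected_rate (alpha z) (gamma * (\sum_(i < N) H i z - B))) => //.
apply: le_trans (normr_projected_rate _ _) _.
rewrite normrM gtr0_norm// ler_wpM2l ?(ltW hgamma)//.
apply: le_trans (ler_normB _ _) _; rewrite lerD2r.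
apply: le_trans (ler_norm_sum _ _ _) _.
rewrite -[N in N%:R]card_ord -sumr_const; apply: ler_sum => i _.
have /andP[? ?] := H1 i (le_trans s0 (ltW sz)).
by rewrite ger0_norm.
Qed.

(** A bound on each finite time interval, from the Lipschitz estimate alone. It is what makes the
    squared price deviation absolutely continuous; the bound uniform in time comes later, from
    monotonicity of the energy. *)
Let price_bounded T : 0 <= T -> exists2 M : R, 0 <= M &
  forall s, 0 <= s <= T -> `|alpha s - alphastar| <= M.
Proof.
move=> T0; exists (`|alpha 0 - alphastar| + gamma * (N%:R + `|B|) * T).
  by rewrite addr_ge0// !mulr_ge0 ?addr_ge0// ltW.
move=> s /andP[s0 sT].
rewrite (_ : alpha s - _ = (alpha 0 - alphastar) + (alpha s - alpha 0));
  last by ring.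
apply: le_trans (ler_normD _ _) _; rewrite lerD2l.
apply: le_trans (price_lipschitz (lexx 0) s0) _.
by rewrite subr0 ler_wpM2l// mulr_ge0 ?addr_ge0// ltW.
Qed.

(** Each potential term is Lipschitz in its timer, and the square is Lipschitz in the price on a
    bounded range, so both inherit absolute continuity from the state variables. *)
Lemma energy_abs_continuous T : 0 <= T ->
  abs_continuous_on 0 T (fun s => Es s).
Proof.
move=> T0; apply: abs_continuous_add.
  apply: abs_continuous_sum => i.
  apply: (@abs_continuous_lipschitz_comp _ _ _ (k i)^-1 (t i)).
  - exact: (sol.2.1 T T0).1.
  - by rewrite invr_ge0 ltW.
  - move=> x y /andP[x0 _] /andP[y0 _].
    rewrite -mulrBr opprB addrA subrK normrM gtr0_norm; last first.
      by rewrite invr_gt0 mulr_gt0.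
    rewrite mulrC ler_pdivrMr ?mulr_gt0// mulrAC mulrA mulVf ?gt_eqF// mul1r.
    by apply: potential_hit_lipschitz => //; exact: t_ge0.
have [M M0 hM] := price_bounded T0.
apply: (@abs_continuous_lipschitz_comp _ _ _ (gamma^-1 * M) alpha).
- exact: (sol.2.1 T T0).2.
- by rewrite mulr_ge0// invr_ge0 ltW.
- move=> x y xT yT.
  rewrite (_ : _ - _ = gamma^-1 * (((alpha y - alphastar) +
      (alpha x - alphastar)) / 2) * (alpha y - alpha x)); last first.
    by field; rewrite gt_eqF.
  rewrite normrM ler_wpM2r// normrM gtr0_norm ?invr_gt0// ler_pM2l ?invr_gt0//.
  rewrite normrM [`|2^-1|]gtr0_norm ?invr_gt0// ler_pdivrMr//.
  apply: le_trans (ler_normD _ _) _.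
  by have := hM _ xT; have := hM _ yT; lra.
Qed.

(** Integrated form of the derivative bound: [eta = 0] yields monotonicity, and a positive [eta] a
    definite drop of the energy. *)
Lemma energy_decrease eta s r : 0 <= s -> s <= r ->
  (forall z, s < z < r -> eta <= \sum_(i < N) dissipation i (H i z)) ->
  Es r <= Es s - eta * (r - s).
Proof.
move=> s0 sr heta; have r0 := le_trans s0 sr.
suff : Es r - Es s <= - eta * (r - s) by lra.
apply: (@abs_continuous_increment_le _ _ _ _ (fun s => Es s)) => //.
  exact: abs_continuous_sub s0 (lexx r) (energy_abs_continuous r0).
apply: ae_imply sol.2.2 => z + szr; have /andP[sz zr] := szr.
have z0 := le_lt_trans s0 sz.
move=> /(_ z0)/(is_derive_energy z0)[d dE dle]; exists d => //.
by apply: le_trans dle _; rewrite lerN2; exact: heta.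
Qed.

Lemma energy_nonincreasing s r : 0 <= s -> s <= r -> Es r <= Es s.
Proof.
move=> s0 sr; have := @energy_decrease 0 s r s0 sr; rewrite mul0r subr0; apply.
move=> z /andP[sz _]; apply: sumr_ge0 => i _; apply: dissipation_ge0.
by apply: H1; exact: le_trans s0 (ltW sz).
Qed.

(** The energy never exceeds its initial value, which bounds the price for all time; the marginal
    utility lies between 0 and [mu i 0], so the rate of the timer is bounded. *)
Lemma timer_lipschitz i : exists2 L : R, 0 < L & forall s r, 0 <= s -> s <= r ->
  `|t i r - t i s| <= L * (r - s).
Proof.
(* With [x = alpha s - alphastar], the energy gives [x ^+ 2 <= 2 * gamma * Es 0], and
   [(x - 1) ^+ 2 >= 0] then bounds [x] without a square root. *)
pose M := alphastar + 2 * gamma * Es 0 + 1.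
have E0 : 0 <= Es 0.
  by apply: energy_ge0 => // j; have /andP[] := H01 j (lexx 0).
have M0 : 0 < M by rewrite /M ltr_wpDl// addr_ge0// mulr_ge0// mulr_ge0// ltW.
have alphaM s : 0 <= s -> alpha s <= M.
  move=> s0; have := energy_nonincreasing (lexx 0) s0.
  have : 1 / (2 * gamma) * (alpha s - alphastar) ^+ 2 <= Es s.
    by apply: energy_ge_price => // j; case/andP: (H01 j s0).
  move=> /le_trans/[apply].
  rewrite mulrAC ler_pdivrMr ?mulr_gt0// mul1r.
  have := mulr_ge0 (ltW hgamma) E0.
  have := sqr_ge0 (alpha s - alphastar - 1).
  by rewrite sqrrB1 /M; lra.
have mu0 : 0 <= mu i 0 by apply: marginal_utility_ge0; rewrite lexx ler01.
exists (k i * (mu i 0 + M)); first by rewrite mulr_gt0// ltr_wpDl.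
move=> s r s0 sr; have r0 := le_trans s0 sr.
apply: abs_continuous_lipschitz => //.
  exact: abs_continuous_sub s0 (lexx r) ((sol.2.1 _ r0).1 i).
apply: ae_imply sol.2.2 => z + /andP[sz _].
move=> /(_ (le_lt_trans s0 sz))[/(_ i) dt _].
exists (projected_rate (t i z) (k i * (mu i (H i z) - alpha z))) => //.
apply: le_trans (normr_projected_rate _ _) _.
rewrite normrM gtr0_norm// ler_pM2l//.
have z0 := le_trans s0 (ltW sz); have /andP[h0 h1] := H1 i z0.
have := alpha_ge0 z0; have := alphaM _ z0.
have := marginal_utility_ge0 i (H1 i z0).
have := marginal_utility_nonincreasing i (lexx 0) h0 h1.
by rewrite ler_norml; lra.
Qed.

(** Instead of counting returns, the infimum of the energy is used: once the energy is within
    [eta * w] of it, a further drop of that size is impossible. *)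
Lemma hit_converges i e : 0 < e -> exists2 S : R, 0 <= S &
  forall s, S <= s -> `|H i s - hstar i| < e.
Proof.
move=> e0; have [hs0 hs1] := hint i.
(* Shrinking [e] keeps the points at distance [d / 2] from [hstar i] inside [[0, 1]], where the
   dissipation bound applies. *)
pose d := Num.min e (Num.min (hstar i) (1 - hstar i)).
have d0 : 0 < d by rewrite !lt_min e0 hs0 subr_gt0.
have de : d <= e by rewrite ge_min lexx.
have dh : d <= hstar i by rewrite !ge_min lexx !orbT.
have dh1 : d <= 1 - hstar i by rewrite !ge_min lexx !orbT.
have d20 : 0 < d / 2 by lra.
have [||eta eta0 heta] := @dissipation_ge_away i _ d20; try lra.
have [L L0 hL] := timer_lipschitz i.
(* The hit probability is Lipschitz in time with constant [lam i * L], so within time [w] it moves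
   by at most [d / 2]. *)
pose w := d / (2 * (lam i * L)).
have w0 : 0 < w by rewrite divr_gt0// !mulr_gt0.
pose A := [set Es s | s in [set s | 0 <= s]].
have Age0 : lbound A 0.
  move=> _ [s /= s0 <-]; apply: energy_ge0 => // j.
  by case/andP: (H01 j s0).
have infA : has_inf A by split; [exists (Es 0), 0; rewrite /= ?lexx|exists 0].
have [_ [S /= S0 <-] hS] := inf_adherent (mulr_gt0 eta0 w0) infA.
exists S => // s Ss; have s0 := le_trans S0 Ss.
rewrite ltNge; apply/negP => es.
have sw : s <= s + w by rewrite lerDl ltW.
have := @energy_decrease eta s (s + w) s0 sw.
have := energy_nonincreasing S0 Ss.
have : inf A <= Es (s + w).
  apply: ge_inf; first by exists 0.
  by exists (s + w) => //=; exact: le_trans s0 sw.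
suff hz : forall z, s < z < s + w -> eta <= \sum_(j < N) dissipation j (H j z).
  by move=> ? ? /(_ hz); rewrite [s + w - s]addrAC subrr add0r; lra.
move=> z /andP[sz zw]; have z0 := le_trans s0 (ltW sz).
(* File [i] alone supplies the lower bound, the other terms being nonnegative. *)
rewrite (bigD1 i)//= ler_wpDr//.
  by apply: sumr_ge0 => j _; apply: dissipation_ge0; exact: H1.
apply: heta; first exact: H1.
have hH := hit_lipschitz c (hlam i) (t_ge0 i s0) (t_ge0 i z0).
have ht : lam i * `|t i z - t i s| <= d / 2.
  apply: (@le_trans _ _ (lam i * (L * w))).
    rewrite ler_pM2l//; apply: le_trans (hL s z s0 (ltW sz)) _.
    by rewrite ler_pM2l//; lra.
  by rewrite /w le_eqVlt; apply/orP; left; apply/eqP; field; rewrite !gt_eqF.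
have := le_trans de es; have := le_trans hH ht.
have := ler_normD (H i z - hstar i) (H i s - H i z).
have -> : H i z - hstar i + (H i s - H i z) = H i s - hstar i by ring.
rewrite (distrC (H i s) (H i z)); lra.
Qed.

Lemma hit_eventually i (f : R -> R) l : f x @[x --> hstar i] --> l ->
  forall e, 0 < e -> exists2 S : R, 0 <= S &
    forall s, S <= s -> `|f (H i s) - l| < e.
Proof.
move=> fl e e0; move/cvgrPdist_lt : fl => /(_ e e0)/nbhs_ballP[d /= d0 fd].
have [S S0 hS] := hit_converges i d0; exists S => // s /hS Hs.
by rewrite distrC; apply: fd; rewrite /ball/= distrC.
Qed.

(* While the price stays away from its limit, the timer moves at a speed bounded
   away from zero, which its convergence forbids. *)
Lemma price_converges (i : 'I_N) e : 0 < e -> exists2 S : R, 0 <= S &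
  forall s, S <= s -> `|alpha s - alphastar| < e.
Proof.
move=> e0; have [hs0 hs1] := hint i.
pose K := gamma * (N%:R + `|B|) + 1.
have K0 : 0 < K by rewrite ltr_wpDl// mulr_ge0 ?addr_ge0// ltW.
have hK s r : 0 <= s -> s <= r -> `|alpha r - alpha s| <= K * (r - s).
  move=> s0 sr; apply: le_trans (price_lipschitz s0 sr) _.
  by rewrite ler_wpM2r ?subr_ge0// lerDl.
(* In time [w] the price moves by at most [e / 2], so a deviation of [e] at time [s] stays at least
   [e / 2], with the same sign, up to [s + w]. *)
pose w := e / (2 * K).
have w0 : 0 < w by rewrite divr_gt0// mulr_gt0.
have Kw : K * w = e / 2 by rewrite /w; field; rewrite gt_eqF.
pose ts := timer c (lam i) (hstar i).
have ts0 : 0 < ts.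
  rewrite lt_neqAle timer_ge0 ?(ltW hs0)// andbT; apply/eqP => ts0.
  have := timerK c (hlam i) hs1; rewrite -/ts -ts0 hit0 => hs.
  by move: hs0; rewrite -hs ltxx.
have [S1 S10 hS1] := hit_eventually (marginal_utility_continuous i)
  (divr_gt0 e0 (ltr0n R 4)).
(* Being within [ts] of [ts] keeps the timer positive. Being within the other bound at both [s] and
   [s + w] limits the displacement to half of [k i * (e / 4) * w]. *)
pose b := Num.min ts (k i * (e / 4) * w / 4).
have kew0 : 0 < k i * (e / 4) * w by rewrite mulr_gt0// mulr_gt0// divr_gt0.
have b0 : 0 < b by rewrite lt_min ts0 divr_gt0.
have bts : b <= ts by rewrite ge_min lexx.
have bkew : b <= k i * (e / 4) * w / 4 by rewrite ge_min lexx orbT.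
have [S2 S20 hS2] := @hit_eventually i (timer c (lam i)) _
  (@timer_continuous R c (lam i) _ hs1) _ b0.
have tS2 s : S2 <= s -> `|t i s - ts| < b.
  move=> S2s; have := hS2 s S2s.
  by rewrite [timer _ _ _]hitK//; apply: t_ge0; exact: le_trans S20 S2s.
exists (Num.max S1 S2); first by rewrite le_max S10.
move=> s; rewrite ge_max => /andP[S1s S2s]; have s0 := le_trans S10 S1s.
rewrite ltNge; apply/negP => es.
have sw : s <= s + w by rewrite lerDl ltW.
have sw0 := le_trans s0 sw.
have tac := abs_continuous_sub s0 (lexx (s + w)) ((sol.2.1 _ sw0).1 i).
(* The timer is positive on this interval, so the projection is inactive and its rate is known
   exactly. *)
have rate : {ae lebesgue_measure, forall z : R, s < z < s + w ->
    is_derive z (1 : R) (t i) (k i * (mu i (H i z) - alpha z))}.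
  apply: ae_imply sol.2.2 => z + /andP[sz _].
  move=> /(_ (le_lt_trans s0 sz))[/(_ i) dt _].
  move: dt; rewrite /projected_rate ifT//.
  have := tS2 z (le_trans S2s (ltW sz)); rewrite ltr_norml => /andP[+ _].
  by move: bts; lra.
have muz z : s < z < s + w -> `|mu i (H i z) - alphastar| < e / 4.
  by move=> /andP[sz _]; apply: hS1; exact: le_trans S1s (ltW sz).
have alz z : s < z < s + w -> `|alpha z - alpha s| <= e / 2.
  move=> /andP[sz zw]; apply: le_trans (hK _ _ s0 (ltW sz)) _.
  by rewrite -Kw ler_pM2l//; lra.
have := tS2 _ S2s; have := tS2 _ (le_trans S2s sw).
rewrite !ltr_norml => /andP[? ?] /andP[? ?].
(* A price deviation of at least [e / 2] against a marginal utility error below [e / 4] leaves a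
   speed of at least [k i * (e / 4)]: the timer falls if the price is too high and rises if it is
   too low. *)
move: es; rewrite ler_normr => /orP[es|es].
- have : t i (s + w) - t i s <= - (k i * (e / 4)) * (s + w - s).
    apply: abs_continuous_increment_le => //.
    apply: ae_imply rate => z + szw => /(_ szw) dt.
    exists (k i * (mu i (H i z) - alpha z)) => //.
    rewrite -mulrN ler_pM2l//.
    by have := muz z szw; have := alz z szw; rewrite ltr_norml ler_norml; lra.
  by rewrite addrAC subrr add0r; lra.
- have : k i * (e / 4) * (s + w - s) <= t i (s + w) - t i s.
    apply: abs_continuous_increment_ge => //.
    apply: ae_imply rate => z + szw => /(_ szw) dt.
    exists (k i * (mu i (H i z) - alpha z)) => //.
    rewrite ler_pM2l//.
    by have := muz z szw; have := alz z szw; rewrite ltr_norml ler_norml; lra.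
  by rewrite addrAC subrr add0r; lra.
Qed.

End Trajectory.

End Dynamics.

(** * Limits at infinity and the stability theorem *)

Lemma cvg_pinfty_of_eventually (R : realType) (f : R -> R) l :
  (forall e, 0 < e -> exists2 S : R, 0 <= S &
     forall s, S <= s -> `|f s - l| < e) ->
  f s @[s --> +oo] --> l.
Proof.
move=> fl; apply/cvgrPdist_lt => e /fl[S S0 hS].
by exists S; split; [exact: num_real|move=> s /ltW/hS; rewrite distrC].
Qed.

Theorem mainTheorem6 (R : realType) (N : nat) (B gamma : R)
    (lam k : 'I_N -> R) (U : 'I_N -> R -> R)
    (hstar : 'I_N -> R) (alphastar : R) (c : ttl_cache)
    (hN : (1 <= N)%N) (hB0 : 0 < B) (hBN : B < N%:R) (hgamma : 0 < gamma)
    (hlam : forall i, 0 < lam i) (hk : forall i, 0 < k i)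
    (hUincr : forall i, {in `[0, 1] &, {homo U i : x y / x <= y}})
    (hUC1 : forall i, C1_on `[0, 1] (U i))
    (hUconc : forall i, strictly_concave_on `[0, 1] (U i))
    (hmax : maximizer U B hstar)
    (hint : forall i, 0 < hstar i /\ hstar i < 1)
    (hmult : forall i, marginal_utility U i (hstar i) = alphastar) :
  let V := lyapunov c lam k gamma hstar alphastar in
  (forall (h : 'I_N -> R) (alpha : R),
     (forall i, 0 <= h i /\ h i < 1) -> 0 <= alpha ->
     0 <= V h alpha /\
     (V h alpha = 0 <-> (forall i, h i = hstar i) /\ alpha = alphastar)) /\
  (forall (t : 'I_N -> R -> R) (alpha : R -> R),
     solution c lam k U gamma B t alpha ->
     (forall s, 0 < s -> ode_at c lam k U gamma B t alpha s ->
        let Vs := fun r => V (fun i => hit c (lam i) (t i r)) (alpha r) in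
        derivable Vs s 1 /\ derive1 Vs s <= 0) /\
     (forall i, hit c (lam i) (t i s) @[s --> +oo] --> hstar i) /\
     alpha s @[s --> +oo] --> alphastar).
Proof.
have hsum : \sum_(i < N) hstar i = B by case: hmax => [[]].
(* The multiplier is a marginal utility of an increasing function; [hN] provides a file at which to
   read it off. *)
have as0 : 0 <= alphastar.
  rewrite -(hmult (Ordinal hN)); apply: marginal_utility_ge0 => //.
  by have [/ltW -> /ltW ->] := hint (Ordinal hN).
split.
  move=> h alpha h01 _.
  have h01' i : 0 <= h i < 1 by have [-> ->] := h01 i.
  have h1 i : h i < 1 by case: (h01 i).
  rewrite lyapunovE//; split; first exact: energy_ge0.
  exact: energy_eq0.
move=> t alpha sol.
have H01 i s : 0 <= s -> 0 <= hit c (lam i) (t i s) < 1.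
  by move=> /(sol.1 _)[ts _]; exact: hit_range.
split; [move=> s s0 ode Vs|split=> [i|]].
- have [d dE dle] := is_derive_energy hgamma hlam hk hint hsum as0 sol s0 ode.
  (* The functions [lyapunov] and [energy] agree along the solution at positive times, and the ball
     of radius [s] around [s] contains only such times, so the derivative carries over. *)
  have [dV dVE] : is_derive s (1 : R) Vs d.
    apply: near_eq_is_derive dE; apply/nbhs_ballP; exists s => //= r.
    rewrite /ball/= ltr_norml => sr; rewrite /Vs lyapunovE// => i.
    by apply: H01; lra.
  split=> //; rewrite derive1E dVE (le_trans dle)// oppr_le0.
  apply: sumr_ge0 => i _; apply: (dissipation_ge0 hUC1 hUconc hint hmult).
  by have /andP[-> /ltW ->] := H01 i s (ltW s0).
- apply: cvg_pinfty_of_eventually => e.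
  exact: (hit_converges hgamma hlam hk hUincr hUC1 hUconc hint hsum hmult as0
    sol).
- apply: cvg_pinfty_of_eventually => e.
  exact: (price_converges hgamma hlam hk hUincr hUC1 hUconc hint hsum hmult as0
    sol (Ordinal hN)).
Qed.
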